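(* Let $n$ be a nonnegative integer, and let $q$, $C$ be indeterminates (with $q^C$ treated as an indeterminate). For an indeterminate $X$ and a positive integer $m$ let $A_m(X)$ denote the $n\times m$ matrix whose entry in row $r$ and column $k$ ($0\le r\le n-1$, $0\le k\le m-1$) is $$[C+r]_q\,[C+r-1]_q\cdots[C+r-k+1]_q\,X^{r-k}$$ (the product of $k$ factors $[C+r]_q,[C+r-1]_q,\dots,[C+r-k+1]_q$; for $k=0$ the entry is $X^r$). Equivalently, each next column arises from the previous one by applying the operator $X^{-C}D_qX^{C}$, where $D_qf(X)=(f(qX)-f(X))/((q-1)X)$. Given a composition $n=m_1+\dots+m_\ell$ of $n$ into positive integers and indeterminates $X_1,\dots,X_\ell$, there holds $$\det_{1\le i,j\le n}\big(A_{m_1}(X_1)\,A_{m_2}(X_2)\cdots A_{m_\ell}(X_\ell)\big)=q^{N_1}\Big(\prod_{i=1}^{\ell}\prod_{j=1}^{m_i-1}[j]_q!\Big)\prod_{1\le i<j\le\ell}\ \prod_{s=0}^{m_i-1}\prod_{t=0}^{m_j-1}\big(q^{t-s}X_j-X_i\big),$$ where the matrix on the left is the $n\times n$ matrix obtained by placing the blocks side by side, and $$N_1=\sum_{i=1}^{\ell}\sum_{j=1}^{m_i}\Big((C+j+m_1+\dots+m_{i-1}-1)(m_i-j)-\binom{m_i}{3}\Big)-\sum_{1\le i<j\le\ell}\Big(m_i\binom{m_j}{2}-m_j\binom{m_i}{2}\Big).$$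
   Context: $[\alpha]_q=(1-q^\alpha)/(1-q)$, $[j]_q!=[j]_q[j-1]_q\cdots[1]_q$, $[0]_q!=1$. Empty products equal $1$.
   Formalization: In N_1 the term binom(m_i,3) is subtracted once for each i rather than inside the sum over j; as printed the formula fails whenever some m_i ≥ 3 (for ℓ=1, m_1=3 the determinant is q^{3C}[2]_q, but the printed N_1 is 3C−2). *)

(* Defs.v *)
From mathcomp Require Import all_boot all_order all_algebra.
From mathcomp Require Import fraction.
From mathcomp Require Import mpoly.

Set Implicit Arguments.
Unset Strict Implicit.
Unset Printing Implicit Defensive.

Import Order.TTheory GRing.Theory Num.Theory.
Local Open Scope ring_scope.

(* Exponents of q: the pair (c, d) stands for the formal expression c * C + d,
   so that q^(c * C + d) = (q^C)^c * q^d, with q^C an independent element. *)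
Notation qexpo := (int * int)%type.

Definition expC : qexpo := (1, 0).
Definition expZ (d : int) : qexpo := (0, d).

Section QCalculus.
Variables (F : fieldType) (q qC : F).

Definition qpow (a : qexpo) : F := qC ^ a.1 * q ^ a.2.

Definition qnum (a : qexpo) : F := (1 - qpow a) / (1 - q).

Definition qfact (j : nat) : F := \prod_(1 <= i < j.+1) qnum (expZ i%:Z).

Definition qblock (n m : nat) (x : F) : 'M[F]_(n, m) :=
  \matrix_(r < n, k < m)
    ((\prod_(i < k) qnum (expC + expZ (r%:Z - i%:Z))) * x ^ (r%:Z - k%:Z)).

End QCalculus.

(* The source prints binom(m_i, 3) inside the inner sum over j, where it would
   be subtracted m_i times; with that reading the determinant evaluation fails
   as soon as some m_i >= 3.  (For l = 1 and m_1 = 3 the determinant is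
   q^(3C) [2]_q, while the printed exponent is 3C - 2.)  Here it is subtracted
   once for each i. *)
Definition qexponent (l : nat) (m : 'I_l -> nat) : qexpo :=
  \sum_(i < l)
     (\sum_(1 <= j < (m i).+1)
         (expC + expZ (j%:Z + (\sum_(k < l | (k < i)%N) m k)%N%:Z - 1))
           *+ (m i - j)%N
      - expZ 'C(m i, 3)%:Z)
  - \sum_(i < l) \sum_(j < l | (i < j)%N)
      expZ ((m i * 'C(m j, 2))%N%:Z - (m j * 'C(m i, 2))%N%:Z).

(* The field K(q, q^C, X_1, ..., X_l) of rational functions in l + 2
   indeterminates: variable 0 is q, variable 1 is q^C, the others are the X_i. *)
Section Indeterminates.
Variables (K : fieldType) (l : nat).

Definition ratfun : fieldType := {fraction {mpoly K[2 + l]}}.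

Definition ind_q : ratfun := tofrac 'X_(lshift l (ord0 : 'I_2)).
Definition ind_qC : ratfun := tofrac 'X_(lshift l (ord_max : 'I_2)).
Definition ind_X (i : 'I_l) : ratfun := tofrac 'X_(rshift 2 i).

End Indeterminates.

Arguments ind_q : clear implicits.
Arguments ind_qC : clear implicits.
Arguments ind_X : clear implicits.

(* Main.v *)
(** Up to the factor [x ^ (r - k)], the entry of [qblock] in row [r] and column
    [k] is a polynomial of degree [k] in [q^(C + r)], and
    [q^(j (C + r)) x^r = q^(j C) (q^j x)^r].  Hence each block is a Vandermonde
    matrix with nodes [x, q x, ..., q^(m - 1) x] times an upper triangular
    matrix, and the determinant is a Vandermonde determinant times the product
    of the diagonal entries of the triangular factors. *)

Require Import Defs.
From mathcomp Require Import all_boot all_order all_algebra.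
From mathcomp Require Import fraction mpoly ring zify.

Set Implicit Arguments.
Unset Strict Implicit.
Unset Printing Implicit Defensive.

Import Order.TTheory GRing.Theory.
Local Open Scope ring_scope.

Section BlockMatrices.
Variables (l : nat) (p : 'I_l -> nat).

(** Reindexing along [tagnat.rank], the bijection from pairs (block, position) to flat indices. *)
Lemma prod_ord_sum (R : comPzRingType) (F : forall i, 'I_(p i) -> R)
    (P : pred {i & 'I_(p i)}) :
  \prod_(k < (\sum_i p i)%N | P (tagnat.sig k))
     F (tagnat.sig1 k) (tagnat.sig2 k)
  = \prod_i \prod_(s < p i | P (Tagged _ s)) F i s.
Proof.
rewrite (reindex _ (onW_bij _ tagnat.rank_bij)) /=.
rewrite sig_big_dep /=; apply: eq_big => [u|u _].
  by rewrite tagnat.rankK; case: u.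
by rewrite /tagnat.sig2 /tagnat.sig1 tagnat.rankK.
Qed.

Lemma det_mxdiag_trig (R : comNzRingType) (B : forall i, 'M[R]_(p i)) :
  (forall i, is_trig_mx (B i)) ->
  \det (\mxdiag_i B i) = \prod_i \prod_(s < p i) B i s s.
Proof.
move=> trigB; rewrite det_trig.
  rewrite -(prod_ord_sum (fun i s => B i s s) predT) /=.
  by apply: eq_bigr => k _; rewrite !mxE eqxx conform_mx_id.
apply/is_trig_mxblockP; split=> [i j lt_ij|i].
  by case: eqVneq lt_ij => // ->; rewrite ltnn.
by rewrite eqxx conform_mx_id.
Qed.

(** Flat indices are ordered lexicographically by block, then position: a pair [k < k'] lies either
    inside one block, or in blocks [i < j] with arbitrary positions. This splits the Vandermonde
    product. *)
Lemma prod_lt_ord_sum (R : comPzRingType)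
    (G : forall i, 'I_(p i) -> forall j, 'I_(p j) -> R) :
  \prod_(k < (\sum_i p i)%N) \prod_(k' < (\sum_i p i)%N | (k < k')%N)
     G (tagnat.sig1 k) (tagnat.sig2 k) (tagnat.sig1 k') (tagnat.sig2 k')
  = (\prod_(i < l) \prod_(t < p i) \prod_(s < p i | (s < t)%N) G i s i t)
    * \prod_(i < l) \prod_(j < l | (i < j)%N) \prod_(s < p i) \prod_(t < p j) G i s j t.
Proof.
have ltE (i j : 'I_l) (s : 'I_(p i)) (t : 'I_(p j)) :
    ((Tagged _ s : {i & 'I_(p i)}) < Tagged _ t)%O
    = (i < j)%N || ((i == j) && (s < t)%N).
  rewrite Order.SigmaOrder.ltEsig /= leEord.
  case: (ltngtP i j) => [//|lt_ji|/val_inj eq_ij] /=.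
    by rewrite -val_eqE /= gtn_eqF.
  by case: _ / eq_ij in t *; rewrite tagged_asE ltEord eqxx.
transitivity (\prod_i \prod_(s < p i) \prod_j
   \prod_(t < p j | ((Tagged _ s : {i & 'I_(p i)}) < Tagged _ t)%O) G i s j t).
  rewrite -(prod_ord_sum
    (fun i s => \prod_j \prod_(t < p j | _) G i s j t) predT) /=.
  apply: eq_bigr => k _.
  rewrite -(prod_ord_sum (fun j t => G _ (tagnat.sig2 k) j t)
              (fun u => (_ < u)%O)) /=.
  apply: eq_bigl => k'.
  by rewrite -[RHS]tagnat.lt_rank -tagnat.sigE12 !tagnat.sigK ltEord.
rewrite -big_split /=; apply: eq_bigr => i _.
transitivity (\prod_(s < p i) ((\prod_(t < p i | (s < t)%N) G i s i t) *
   \prod_(j < l | (i < j)%N) \prod_(t < p j) G i s j t)).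
  apply: eq_bigr => s _; rewrite (bigD1 i) //=; congr (_ * _).
    by apply: eq_bigl => t; rewrite ltE ltnn eqxx.
  rewrite [LHS](bigID (fun j : 'I_l => (i < j)%N)) /= [X in _ * X]big1 ?mulr1.
    apply: eq_big => [j|j /andP[_ lt_ij]].
      by rewrite andbC; case: eqVneq => [->|]; rewrite ?ltnn ?andbT.
    by apply: eq_bigl => t; rewrite ltE lt_ij.
  move=> j /andP[neq_ji /negPf nlt_ij]; apply: big_pred0 => t.
  by rewrite ltE nlt_ij eq_sym (negPf neq_ji).
rewrite big_split /=; congr (_ * _); last by rewrite exchange_big.
(* Inside a block the larger position [t] becomes the outer index. *)
by rewrite (exchange_big_dep predT).
Qed.

End BlockMatrices.

Lemma sum_ord_binomial2 (m : nat) : (\sum_(s < m) s = 'C(m, 2))%N.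
Proof. by rewrite -(big_mkord xpredT id) bin2_sum. Qed.

(** [M] stands for the total size of the preceding blocks. The sum of (j - 1)(m - j) over j is
    binom(m, 3), which the subtracted term cancels; the sum of m - j is binom(m, 2). *)
Lemma qexponent_block (m M : nat) :
  \sum_(1 <= j < m.+1) (expC + expZ (j%:Z + M%:Z - 1)) *+ (m - j)%N
    - expZ 'C(m, 3)%:Z
  = ('C(m, 2)%:Z, (M * 'C(m, 2))%N%:Z).
Proof.
suff -> : \sum_(1 <= j < m.+1) (expC + expZ (j%:Z + M%:Z - 1)) *+ (m - j)%N
  = ('C(m, 2)%:Z, (M * 'C(m, 2) + 'C(m, 3))%N%:Z).
  by congr (_, _) => /=; lia.
rewrite big_add1 /=.
have sumE k : \sum_(0 <= j < k) (expC + expZ (j.+1%:Z + M%:Z - 1))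
    = (k%:Z, (M * k + 'C(k, 2))%N%:Z).
  elim: k => [|k IHk]; first by rewrite big_geq // muln0.
  rewrite big_nat_recr //= IHk /expC /expZ.
  by congr (_, _) => /=; rewrite ?binS ?bin1; nia.
elim: m => [|m IHm]; first by rewrite big_geq // muln0.
rewrite big_nat_recr //= subnn mulr0n addr0.
under eq_big_nat => j /andP[_ lt_jm] do rewrite subSn // mulrSr.
rewrite big_split /= IHm sumE.
by congr (_, _) => /=; rewrite !binS ?bin1; nia.
Qed.

(** Summing [M * 'C(m, 2)] over the blocks gives the sum over i < j of m_i binom(m_j, 2), which
    cancels the first half of the double sum in [qexponent]. *)
Lemma qexponentE (l : nat) (m : 'I_l -> nat) :
  qexponent m
  = ((\sum_(i < l) 'C(m i, 2))%N%:Z,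
     (\sum_(i < l) \sum_(j < l | (i < j)%N) m j * 'C(m i, 2))%N%:Z).
Proof.
rewrite /qexponent.
under eq_bigr => i _ do rewrite qexponent_block.
have fst_sum I (r : seq I) (P : pred I) (F : I -> qexpo) :
  (\sum_(i <- r | P i) F i).1 = \sum_(i <- r | P i) (F i).1 by exact: raddf_sum.
have snd_sum I (r : seq I) (P : pred I) (F : I -> qexpo) :
  (\sum_(i <- r | P i) F i).2 = \sum_(i <- r | P i) (F i).2 by exact: raddf_sum.
have Posz_sum := big_morph Posz PoszD (erefl _).
rewrite [LHS]surjective_pairing /= !fst_sum !snd_sum /=; congr (_, _).
  rewrite [X in _ - X]big1 ?subr0 ?Posz_sum // => i _.
  by rewrite fst_sum big1.
have -> : \sum_(i < l) ((\sum_(k < l | (k < i)%N) m k) * 'C(m i, 2))%N%:Z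
    = \sum_(i < l) \sum_(j < l | (i < j)%N) (m i * 'C(m j, 2))%N%:Z.
  rewrite [RHS](exchange_big_dep predT) //=; apply: eq_bigr => i _.
  by rewrite big_distrl Posz_sum.
rewrite Posz_sum -sumrB; apply: eq_bigr => i _.
rewrite snd_sum Posz_sum -sumrB; apply: eq_bigr => j _ /=.
by rewrite opprB addrC subrK.
Qed.

Section LinearProducts.
Variables (R : comNzRingType) (a b : nat -> R).

Definition linprod (k : nat) : {poly R} := \prod_(i < k) ((a i)%:P + b i *: 'X).

Lemma linprodS k : linprod k.+1 = linprod k * ((a k)%:P + b k *: 'X).
Proof. exact: big_ord_recr. Qed.

Lemma horner_linprod k y : (linprod k).[y] = \prod_(i < k) (a i + b i * y).
Proof. by rewrite horner_prod; apply: eq_bigr => i _; rewrite !hornerE. Qed.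

Lemma size_linprod k : (size (linprod k) <= k.+1)%N.
Proof.
elim: k => [|k IHk]; first by rewrite /linprod big_ord0 size_poly1.
rewrite linprodS (leq_trans (size_polyMleq _ _)) //.
have size_lin : (size ((a k)%:P + b k *: 'X)%R <= 2)%N.
  rewrite (leq_trans (size_polyD _ _)) // geq_max.
  rewrite (leq_trans (size_polyC_leq1 _)) //.
  by rewrite (leq_trans (size_scale_leq _ _)) // size_polyX.
by lia.
Qed.

Lemma coef_linprod_gt k j : (k < j)%N -> (linprod k)`_j = 0.
Proof. by move=> lt_kj; rewrite nth_default // (leq_trans (size_linprod k)). Qed.

Lemma coef_linprod k : (linprod k)`_k = \prod_(i < k) b i.
Proof.
elim: k => [|k IHk]; first by rewrite /linprod !big_ord0 coef1.
rewrite linprodS mulrDr coefD coefMC -scalerAr coefZ coefMX /= IHk.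
by rewrite coef_linprod_gt // mul0r add0r big_ord_recr mulrC.
Qed.

End LinearProducts.

Section Evaluation.
Variables (F : fieldType) (q qC : F).
Hypotheses (q0 : q != 0) (q1 : 1 - q != 0).

(** The factor of index i is (1 - q^(-i) y) / (1 - q), which equals [C + r - i] at y = q^(C + r). *)
Definition qblock_poly : nat -> {poly F} :=
  linprod (fun=> (1 - q)^-1) (fun i => - q ^- i / (1 - q)).

Definition qnode (x : F) (s : nat) : F := q ^+ s * x.

Definition qblock_trans (m : nat) (x : F) : 'M[F]_m :=
  \matrix_(j < m, k < m) (x ^- k * qC ^+ j * (qblock_poly k)`_j).

Lemma qblock_factor n m (x : F) : x != 0 ->
  qblock q qC n m x
  = Vandermonde n (\row_(s < m) qnode x s) *m qblock_trans m x.
Proof.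
move=> x0; apply/matrixP => r k; rewrite !mxE.
have -> : \prod_(i < k) qnum q qC (expC + expZ (r%:Z - i%:Z))
    = (qblock_poly k).[qC * q ^+ r].
  rewrite horner_linprod; apply: eq_bigr => i _.
  rewrite /qnum /qpow /= addr0 add0r expr1z expfzDr // exprnN.
  by rewrite -exprnP; ring.
(* The degree is at most [k < m], so the expansion can run over all [m] nodes. *)
rewrite (horner_coef_wide _ (leq_trans (size_linprod _ _ k) (ltn_ord k))).
rewrite mulr_suml; apply: eq_bigr => j _; rewrite !mxE /qnode.
rewrite expfzDr // -exprnP exprnN !exprMn -exprM mulnC exprM.
by ring.
Qed.

Lemma qblock_trans_trig m x : is_trig_mx (qblock_trans m x)^T.
Proof.
by apply/is_trig_mxP => i j lt_ij; rewrite !mxE coef_linprod_gt // mulr0.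
Qed.

(** The difference q^t x - q^s x = -q^s x (1 - q^(t - s)) meets the factor -x^(-1) q^C q^(-s) / (1 -
    q) of the diagonal entry [t]; together they give q^C [t - s]. The product over s < t is q^(tC)
    [t]!. *)
Lemma qnode_block_prod m (x : F) : x != 0 ->
  (\prod_(t < m) \prod_(s < m | (s < t)%N) (qnode x t - qnode x s))
    * \prod_(t < m) qblock_trans m x t t
  = qC ^+ 'C(m, 2) * \prod_(1 <= j < m) qfact q qC j.
Proof.
move=> x0; rewrite -sum_ord_binomial2 -big_split /=.
(* The added index 0 contributes the empty product [0]! = 1. *)
have -> : \prod_(1 <= j < m) qfact q qC j = \prod_(t < m) qfact q qC t.
  rewrite -(big_mkord xpredT (qfact q qC)).
  case: m => [|m]; first by rewrite !big_geq.
  by rewrite [RHS]big_ltn // [X in X * _]big_geq // mul1r.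
rewrite expr_sum -big_split /=; apply: eq_bigr => t _.
rewrite mxE coef_linprod /qnode.
rewrite (big_ord_narrow (ltnW (ltn_ord t))) /=.
have expr_prod (z : F) : z ^+ t = \prod_(s < t) z by rewrite prodr_const card_ord.
rewrite -exprVn (expr_prod x^-1) (expr_prod qC) -!big_split /=.
(* Reversal turns the factor [s + 1] of [t]! into [t - s]. *)
rewrite /qfact big_add1 /= big_mkord (reindex_inj rev_ord_inj) /= -big_split /=.
apply: eq_bigr => s _; rewrite /qnum /qpow /= expr0z mul1r.
rewrite -exprnP -[in q ^+ t](subnK (ltn_ord s)) exprD.
by field; rewrite x0 q1 expf_neq0.
Qed.

Variables (l : nat) (m : 'I_l -> nat) (X : 'I_l -> F).
Hypothesis X0 : forall i, X i != 0.

Lemma qblock_det :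
  \det (\mxrow_(i < l) qblock q qC (\sum_i m i)%N (m i) (X i))
  = qpow q qC (qexponent m)
    * (\prod_(i < l) \prod_(1 <= j < m i) qfact q qC j)
    * \prod_(i < l) \prod_(j < l | (i < j)%N)
        \prod_(s < m i) \prod_(t < m j) (q ^ (t%:Z - s%:Z) * X j - X i).
Proof.
set n := (\sum_i m i)%N.
under eq_mxrow => i do rewrite qblock_factor //.
rewrite -mul_mxrow_mxdiag det_mulmx.
have -> : \mxrow_i Vandermonde n (\row_(s < m i) qnode (X i) s)
    = Vandermonde n (\mxrow_i (\row_(s < m i) qnode (X i) s)).
  by apply/matrixP => r k; rewrite !mxE.
(* [is_trig_mx] means lower triangular, whereas the factors are upper triangular; hence the
   transpose. *)
rewrite det_Vandermonde -[X in _ * X]det_tr tr_mxdiag det_mxdiag_trig; last first.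
  by move=> i; apply: qblock_trans_trig.
under [X in X * _]eq_bigr => k _ do under eq_bigr => k' _ do rewrite !mxE.
have /= -> := @prod_lt_ord_sum _ m _
  (fun i s j t => qnode (X j) t - qnode (X i) s).
under [X in _ * X]eq_bigr => i _ do under eq_bigr => s _ do rewrite mxE.
(* Each block's own node differences are paired with its triangular diagonal. *)
rewrite mulrAC -big_split /=.
under eq_bigr => i _ do rewrite qnode_block_prod //.
rewrite big_split /= prodrXr qexponentE /qpow /= -!exprnP.
rewrite -!mulrA; congr (_ * _); rewrite mulrCA; congr (_ * _).
(* Across blocks, q^t X_j - q^s X_i = q^s (q^(t - s) X_j - X_i); for fixed i < j the extracted
   powers multiply to q^(m_j binom(m_i, 2)). *)
rewrite expr_sum -big_split /=; apply: eq_bigr => i _.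
rewrite expr_sum -big_split /=; apply: eq_bigr => j lt_ij.
rewrite mulnC -sum_ord_binomial2 exprM expr_sum -prodrXl -big_split /=.
apply: eq_bigr => s _.
have -> : (q ^+ s) ^+ m j = \prod_(t < m j) q ^+ s.
  by rewrite prodr_const card_ord.
rewrite -big_split /=.
apply: eq_bigr => t _; rewrite /qnode expfzDr // -exprnN -exprnP.
by field; rewrite expf_neq0.
Qed.

End Evaluation.

Theorem theorem23 (K : fieldType) (n l : nat) (m : 'I_l -> nat)
    (m_gt0 : forall i, (0 < m i)%N) (sum_m : (\sum_(i < l) m i)%N = n) :
  let q := ind_q K l in
  let qC := ind_qC K l in
  let X := ind_X K l in
  \det (castmx (erefl n, sum_m) (\mxrow_(i < l) qblock q qC n (m i) (X i)))
  = qpow q qC (qexponent m)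
    * (\prod_(i < l) \prod_(1 <= j < m i) qfact q qC j)
    * \prod_(i < l) \prod_(j < l | (i < j)%N)
        \prod_(s < m i) \prod_(t < m j) (q ^ (t%:Z - s%:Z) * X j - X i).
Proof.
move=> q qC X; case: n / sum_m; rewrite castmx_id.
have X0 (i : 'I_(2 + l)) : 'X_i != 0 :> {mpoly K[2 + l]}.
  by rewrite -msupp_eq0 msuppX.
apply: qblock_det => [||i]; rewrite ?tofrac_eq0 ?X0 //.
(* The indeterminate q differs from 1 because their degrees are 1 and 0. *)
rewrite -tofrac1 -tofracB tofrac_eq0 subr_eq0 -mpolyX0.
apply/eqP => /(congr1 (fun P => msize P)).
by rewrite !msizeX mdeg0 mdeg1.
Qed.
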